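(* For every topological space $X$, the following are equivalent: (1) $X$ is locally strongly sober; (2) $X$ is a weakly Hausdorff, weakly coherent, monotone convergence space; (3) $X$ is a weakly Hausdorff, coherent, sober space.
   Context: No separation axiom is assumed unless stated; compact means that every open cover has a finite subcover (no Hausdorff requirement). The specialization preordering $\leq$ of a space $X$ is defined by $x \leq y$ iff every open neighborhood of $x$ contains $y$; $\uparrow x = \{y \mid x \leq y\}$ and $\downarrow x = \{y \mid y \leq x\}$, which equals the closure of $\{x\}$. A subset is saturated iff it is equal to the intersection of its open neighborhoods, equivalently iff it is upwards-closed in $\leq$. A space $X$ is weakly Hausdorff iff for all $x, y \in X$, every open set $W$ containing $\uparrow x \cap \uparrow y$ contains an intersection $U \cap V$ of an open neighborhood $U$ of $x$ and an open neighborhood $V$ of $y$. $X$ is coherent iff the intersection of any two compact saturated subsets is compact. $X$ is weakly coherent iff $\uparrow x \cap \uparrow y$ is compact for all points $x, y \in X$. $X$ is sober iff every irreducible closed subset is the closure $\downarrow x$ of a unique point $x$, where a closed set $C$ is irreducible iff it is non-empty and whenever it intersects two open sets it intersects their intersection. $X$ is a monotone convergence space iff it is $T_0$, every subset $D$ that is directed with respect to $\leq$ has a supremum, and every open set is Scott-open with respect to $\leq$. (Directed: every finite subfamily of $D$ has an upper bound in $D$; in particular $D$ is non-empty. Scott-open: an upwards-closed set $U$ such that for every directed family $D$, $\sup D \in U$ implies that some element of $D$ is in $U$.) For an ultrafilter $\mathcal U$ (of subsets of $X$), $\lim \mathcal U$ is the set of points $x$ such that every open neighborhood of $x$ is in $\mathcal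 U$. $X$ is locally strongly sober iff, for every ultrafilter $\mathcal U$ on $X$, $\lim \mathcal U$ is either empty or the closure $\downarrow x$ of a unique point $x$. *)

(* Defs.v *)
From mathcomp Require Import all_boot all_classical.
From mathcomp Require Import topology_structure compact separation_axioms.

Set Implicit Arguments.
Unset Strict Implicit.
Unset Printing Implicit Defensive.

Local Open Scope classical_set_scope.

Section Definitions.
Context (X : topologicalType).
Implicit Types (x y s d u : X) (A C D F K L U V W : set X).

Definition spec_le x y : Prop := forall U, open_nbhs x U -> U y.

Definition upset x : set X := [set y | spec_le x y].

Definition saturated A : Prop :=
  A = \bigcap_(U in [set U | open U /\ A `<=` U]) U.

Definition weakly_hausdorff : Prop :=
  forall x y W, open W -> upset x `&` upset y `<=` W ->
    exists U V, [/\ open_nbhs x U, open_nbhs y V & U `&` V `<=` W].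

Definition coherent : Prop :=
  forall K L, cover_compact K -> saturated K -> cover_compact L -> saturated L ->
    cover_compact (K `&` L).

Definition weakly_coherent : Prop :=
  forall x y, cover_compact (upset x `&` upset y).

Definition irreducible C : Prop :=
  C !=set0 /\
  forall U V, open U -> open V ->
    C `&` U !=set0 -> C `&` V !=set0 -> C `&` (U `&` V) !=set0.

Definition sober : Prop :=
  forall C, closed C -> irreducible C -> exists! x, C = closure [set x].

Definition spec_ub D u : Prop := forall d, D d -> spec_le d u.

Definition spec_sup D s : Prop :=
  spec_ub D s /\ forall u, spec_ub D u -> spec_le s u.

(* Taking [F] empty shows that directed sets are non-empty. *)
Definition directed D : Prop :=
  forall F, finite_set F -> F `<=` D -> exists2 d, D d & spec_ub F d.

Definition scott_open U : Prop :=
  (forall x y, spec_le x y -> U x -> U y) /\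
  forall D s, directed D -> spec_sup D s -> U s -> D `&` U !=set0.

Definition monotone_convergence_space : Prop :=
  [/\ kolmogorov_space X,
      forall D, directed D -> exists s, spec_sup D s
    & forall U, open U -> scott_open U].

Definition ultra_lim (F : set_system X) : set X := [set x | F --> x].

Definition locally_strongly_sober : Prop :=
  forall F : set_system X, UltraFilter F ->
    ultra_lim F = set0 \/ exists! x, ultra_lim F = closure [set x].

End Definitions.

Arguments weakly_hausdorff : clear implicits.
Arguments coherent : clear implicits.
Arguments weakly_coherent : clear implicits.
Arguments sober : clear implicits.
Arguments monotone_convergence_space : clear implicits.
Arguments locally_strongly_sober : clear implicits.

(* Main.v *)
(** The crux is [upset_cvg]: in a weakly Hausdorff space, if an ultrafilter
    converges to x and to y and ↑x ∩ ↑y is compact, then it converges to some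
    point of ↑x ∩ ↑y; otherwise finitely many open sets outside the ultrafilter
    cover ↑x ∩ ↑y, and weak Hausdorffness puts their union in the ultrafilter.
    Hence sets of limits are directed, which gives local strong sobriety from
    sobriety, and coherence from weak coherence.  Conversely, when sets of
    limits are principal, weak Hausdorffness, weak coherence and suprema of
    directed sets all come from ultrafilters refining a suitable filter base. *)
Require Import Defs.
From HB Require Import structures.
From mathcomp Require Import all_boot finmap all_classical.
From mathcomp Require Import topology_structure compact separation_axioms.

Set Implicit Arguments.
Unset Strict Implicit.
Unset Printing Implicit Defensive.

Local Open Scope classical_set_scope.

(* The library proves [compact_cover] for pointed spaces only. *)
Lemma compact_coverE (X : topologicalType) : @compact X = @cover_compact X.
Proof.
have [[x _]|X0] := pselect ([set: X] !=set0).
  pose T := HB.pack_for ptopologicalType X (isPointed.Build X x).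
  exact: (@compact_cover T).
apply/funext => K; have -> : K = set0.
  by rewrite -subset0 => x _; apply: X0; exists x.
rewrite propeqE; split=> _; last exact: compact0.
by move=> I D f _ _; exists fset0.
Qed.

(** * Specialization preorder and saturated sets *)

Section Specialization.
Context {X : topologicalType}.
Implicit Types (x y z : X) (A C D K U V W : set X) (F : set_system X).

Lemma spec_le_refl x : spec_le x x.
Proof. by move=> U []. Qed.
#[local] Hint Resolve spec_le_refl : core.

Lemma spec_le_trans y x z : spec_le x y -> spec_le y z -> spec_le x z.
Proof. by move=> xy yz U oU; apply: yz; split; [case: oU | exact: xy]. Qed.

Lemma open_spec_le U x y : open U -> spec_le x y -> U x -> U y.
Proof. by move=> oU xy Ux; apply: xy. Qed.

Lemma closure1P x y : closure [set x] y <-> spec_le y x.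
Proof.
split=> [cxy U [oU Uy]|yx U].
  by have [z [-> //]] := cxy U (open_nbhs_nbhs (conj oU Uy)).
by rewrite nbhsE => -[V /yx Vx VU]; exists x; split=> //; apply: VU.
Qed.

Lemma closure1_anti x y : kolmogorov_space X ->
  closure [set x] = closure [set y] -> x = y.
Proof.
move=> T0 cxy; apply/eqP/negPn/negP => /T0[A].
have xy : spec_le x y by apply/closure1P; rewrite -cxy; apply/closure1P.
have yx : spec_le y x by apply/closure1P; rewrite cxy; apply/closure1P.
by rewrite !inE nbhsE nbhsE => -[] [[U oU UA]]; apply; apply: UA;
  [apply: xy|apply: yx].
Qed.

Lemma saturated_upset A x y : saturated A -> A x -> spec_le x y -> A y.
Proof.
move=> sA Ax xy; rewrite sA => U [oU AU].
by apply: (open_spec_le oU xy); apply: AU.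
Qed.

Lemma upset_saturated x : saturated (upset x).
Proof.
apply/seteqP; split=> [y xy U [_]|y h U [oU Ux]]; first exact.
by apply: (h U); split=> // z xz; apply: open_spec_le xz Ux.
Qed.

(** Open sets are upwards closed, so a member of the cover that contains [x] already covers
    everything above it. *)
Lemma upset_compact x : cover_compact (upset x).
Proof.
move=> I D f fo cov; have [i Di fxi] := cov x (@spec_le_refl x).
exists [fset i]%fset; first by move=> j; rewrite inE => /eqP ->; rewrite inE.
move=> y xy; exists i; first by rewrite /= inE.
exact: (open_spec_le (fo i Di) xy fxi).
Qed.

Lemma coherent_weakly_coherent : coherent X -> weakly_coherent X.
Proof.
by move=> coh x y; apply: coh;
  [exact: upset_compact|exact: upset_saturated
  |exact: upset_compact|exact: upset_saturated].
Qed.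

(** * Directed sets and irreducible sets *)

Lemma directed0 D : directed D -> D !=set0.
Proof. by move=> /(_ set0)[//|//|d Dd _]; exists d. Qed.

Lemma directed2 D x y : directed D -> D x -> D y ->
  exists z, [/\ D z, spec_le x z & spec_le y z].
Proof.
move=> dD Dx Dy; have [||z Dz zub] := dD [set x; y].
- exact: finite_set2.
- by move=> _ [->|->].
by exists z; split=> //; apply: zub; [left|right].
Qed.

Lemma directedI D : D !=set0 ->
  (forall x y, D x -> D y -> exists z, [/\ D z, spec_le x z & spec_le y z]) ->
  directed D.
Proof.
move=> [x0 Dx0] D2 _ /finite_seqP[s ->].
elim: s => [|x s IHs] sD; first by exists x0.
have [|y Dy yub] := IHs; first by move=> z zs; apply: sD; rewrite /= inE zs orbT.
have [|z [Dz xz yz]] := D2 x y _ Dy; first by apply: sD; rewrite /= inE eqxx.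
exists z => // t; rewrite /= inE => /orP[/eqP -> //|ts].
exact: spec_le_trans (yub _ ts) yz.
Qed.

Lemma directed_irreducible C : directed C -> irreducible C.
Proof.
move=> dC; split=> [|U V oU oV [x [Cx Ux]] [y [Cy Vy]]]; first exact: directed0.
have [z [Cz xz yz]] := directed2 dC Cx Cy.
by exists z; split=> //; split; [apply: xz|apply: yz].
Qed.

Lemma irreducible_directed C : weakly_hausdorff X ->
  closed C -> irreducible C -> directed C.
Proof.
move=> wH cC [C0 irr]; apply: directedI => // x y Cx Cy.
apply: contrapT => nz; have [||U [V [[oU Ux] [oV Vy] UV]]] := wH x y (~` C).
- exact: closed_openC.
- by move=> z [xz yz] Cz; apply: nz; exists z.
have [||z [Cz /UV]] := irr U V oU oV; last exact.
- by exists x.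
- by exists y.
Qed.

(** * Limits of ultrafilters *)

Lemma ultra_limP F x : Filter F ->
  ultra_lim F x <-> forall U, open_nbhs x U -> F U.
Proof.
move=> FF; split=> [Fx U oU|h U]; first exact/Fx/open_nbhs_nbhs.
by rewrite nbhsE => -[V /h FV VU]; apply: filterS FV.
Qed.

Lemma ultra_limN F x : Filter F -> ~ ultra_lim F x ->
  exists2 U, open_nbhs x U & ~ F U.
Proof.
move=> FF; apply: contra_notP => nU; apply/ultra_limP => U oU.
by apply: contrapT => nFU; apply: nU; exists U.
Qed.

Lemma ultra_lim_down F x y : Filter F ->
  spec_le x y -> ultra_lim F y -> ultra_lim F x.
Proof.
move=> FF xy /ultra_limP Fy; apply/ultra_limP => U oU.
by apply: Fy; split; [case: oU|apply: xy].
Qed.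

Lemma ultra_lim_closed F : Filter F -> closed (ultra_lim F).
Proof.
move=> FF x clx; apply/ultra_limP => U oU.
have [y [/ultra_limP Fy Uy]] := clx U (open_nbhs_nbhs oU).
by apply: Fy; split=> //; case: oU.
Qed.

(** Each point of [K] has an open neighborhood outside [F]. Finitely many of these cover [K], and
    their union stays outside [F] because [F] contains all their complements. *)
Lemma compact_ultra_cover F K : UltraFilter F -> cover_compact K ->
  (forall x, K x -> ~ ultra_lim F x) -> exists W, [/\ open W, K `<=` W & ~ F W].
Proof.
move=> UF cK nK.
have [||s sD Ks] := cK (set X) [set U | open U /\ ~ F U] id.
- by move=> U [].
- by move=> x /nK/ultra_limN[U [oU Ux] nFU]; exists U.
exists (cover [set` s] id); split=> //.
  by apply: bigcup_open => U /sD; rewrite inE => -[].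
move=> Fs; suff Fn : F (\bigcap_(U in [set` s]) ~` U).
  by have [x [[U sU Ux] /(_ U sU)]] := filter_ex (filterI Fs Fn); apply.
apply: filter_bigI => U /sD; rewrite inE => -[_ nFU].
by have [] := in_ultra_setVsetC U UF.
Qed.

Lemma upset_cvg F x y : weakly_hausdorff X -> UltraFilter F ->
  cover_compact (upset x `&` upset y) -> ultra_lim F x -> ultra_lim F y ->
  exists z, [/\ ultra_lim F z, spec_le x z & spec_le y z].
Proof.
move=> wH UF cxy /ultra_limP Fx /ultra_limP Fy; apply: contrapT => nz.
have [|W [oW sW]] := compact_ultra_cover UF cxy.
  by move=> z [xz yz] Fz; apply: nz; exists z.
have [U [V [oU oV UVW]]] := wH x y W oW sW.
by apply; apply: filterS UVW _; apply: filterI; [apply: Fx|apply: Fy].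
Qed.

(** * Coherence, sobriety and local strong sobriety of weakly Hausdorff spaces *)

Lemma weakly_coherent_coherent :
  weakly_hausdorff X -> weakly_coherent X -> coherent X.
Proof.
move=> wH wC K L; rewrite -!compact_coverE compact_ultra.
move=> cK sK cL sL F UF FKL.
have [x [Kx Fx]] : K `&` ultra_lim F !=set0.
  by apply: cK; apply: filterS FKL; apply: subIsetl.
have [y [Ly Fy]] : L `&` ultra_lim F !=set0.
  by apply: cL; apply: filterS FKL; apply: subIsetr.
(* A limit above both [x] and [y] lies in [K] and in [L] by saturation. *)
have [z [Fz xz yz]] := upset_cvg wH UF (wC x y) Fx Fy.
by exists z; split=> //; split;
  [apply: saturated_upset xz|apply: saturated_upset yz].
Qed.

(** An irreducible closed set is directed. Its supremum cannot lie in the complement, which is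
    Scott-open and disjoint from the set, so it is a greatest element. *)
Lemma monotone_convergence_sober :
  weakly_hausdorff X -> monotone_convergence_space X -> sober X.
Proof.
move=> wH [T0 sup scott] C cC irrC.
have dC := irreducible_directed wH cC irrC.
have [s ssup] := sup C dC; have [sub _] := ssup.
have Cs : C s.
  apply: contrapT => nCs; have [_ sC] := scott _ (closed_openC cC).
  by have [x []] := sC C s dC ssup nCs.
have CE : C = closure [set s].
  apply/seteqP; split=> [x /sub /closure1P //|x sx].
  by apply: cC => U /sx[_ [-> Us]]; exists s.
by exists s; split=> // y Cy; apply: closure1_anti; rewrite // -CE.
Qed.

Lemma sober_locally_strongly_sober :
  weakly_hausdorff X -> weakly_coherent X -> sober X -> locally_strongly_sober X.
Proof.
move=> wH wC sob F UF; have [F0|/set0P F0] := eqVneq (ultra_lim F) set0.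
  by left.
right; apply: sob; first exact: ultra_lim_closed.
apply: directed_irreducible; apply: directedI => // x y Fx Fy.
exact: upset_cvg (wC x y) Fx Fy.
Qed.

(** * Consequences of local strong sobriety *)

Section LocallyStronglySober.
Hypothesis lss : locally_strongly_sober X.

Lemma lss_ultra_lim F x0 : UltraFilter F -> ultra_lim F x0 ->
  exists2 z, ultra_lim F z & forall x, ultra_lim F x -> spec_le x z.
Proof.
move=> UF Fx0; have [F0|[z [Fz _]]] := lss UF; first by rewrite F0 in Fx0.
exists z; first by rewrite Fz; apply/closure1P.
by move=> x; rewrite Fz => /closure1P.
Qed.

(** Every point closure is the limit set of a principal ultrafilter, so the uniqueness clause
    identifies points with equal closures. *)
Lemma lss_kolmogorov : kolmogorov_space X.
Proof.
move=> x y; apply: contra_neqP => nA.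
have limE z : ultra_lim (principal_filter z) = closure [set z].
  have PF := principal_filter_proper z.
  apply/seteqP; split=> t.
    by move=> /ultra_limP h; apply/closure1P => U /h /principal_filterP.
  by move=> /closure1P h; apply/ultra_limP => U /h /principal_filterP.
have [x0|[z [_ zE]]] := lss (principal_filter_ultra x).
  have : closure [set x] x by apply/closure1P.
  by rewrite -limE x0.
(* An open set around [u] missing [v] would separate [x] from [y]; the symmetric form yields both
   inequalities. *)
have le u v : x = u /\ y = v \/ x = v /\ y = u -> spec_le u v.
  move=> uv U oU; apply: contrapT => nUv; apply: nA; exists U.
  have nU := open_nbhs_nbhs oU.
  by case: uv => -[-> ->]; [left|right]; rewrite !inE.
rewrite -(zE x (limE x)); apply: zE; rewrite limE.
by apply/seteqP; split=> t /closure1P tx; apply/closure1P;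
  apply: spec_le_trans tx _; apply: le; [left|right].
Qed.

(** If no [U]&[V] fits inside [W], the traces of these sets on [~] W[generate a proper filter. A
    finer ultrafilter converges to]x[and]y[; its greatest limit lies above both, hence
    in]W[, which forces]W[into the ultrafilter along with]~[W]. *)
Lemma lss_weakly_hausdorff : weakly_hausdorff X.
Proof.
move=> x y W oW sW; apply: contrapT => nUV.
pose B (P : set X * set X) := P.1 `&` P.2 `&` ~` W.
pose I := [set P : set X * set X | open_nbhs x P.1 /\ open_nbhs y P.2].
have PF : ProperFilter (filter_from I B).
  apply: filter_from_proper.
    apply: filter_from_filter.
      by exists (setT, setT); split; split=> //; exact: openT.
    move=> [U V] [U' V'] [/= oU oV] [/= oU' oV'].
    exists (U `&` U', V `&` V'); first by split; apply: open_nbhsI.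
    by move=> t [[[? ?] [? ?]] ?].
  move=> [U V] [/= oU oV]; apply: contrapT => B0; apply: nUV.
  exists U, V; split=> // t UVt; apply: contrapT => nWt.
  by apply: B0; exists t.
have [G [UG sG]] := ultraFilterLemma PF.
have inG U V : open_nbhs x U -> open_nbhs y V -> G (U `&` V `&` ~` W).
  by move=> oU oV; apply: sG; exists (U, V).
have oT z : open_nbhs z [set: X] by split=> //; exact: openT.
have Gx : ultra_lim G x.
  by apply/ultra_limP => U /inG /(_ (oT y)); apply: filterS => t [[]].
have Gy : ultra_lim G y.
  by apply/ultra_limP => V /(inG _ _ (oT x)); apply: filterS => t [[]].
have [z /ultra_limP Gz zub] := lss_ultra_lim UG Gx.
have GW : G W by apply: Gz; split=> //; apply: sW; split; apply: zub.
have GnW : G (~` W) by apply: filterS (inG _ _ (oT x) (oT y)) => t [].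
by have [t []] := filter_ex (filterI GW GnW).
Qed.

(** An ultrafilter containing the intersection converges to [x] and to [y], whose neighborhoods
    include their upsets; its greatest limit is then above both. *)
Lemma lss_weakly_coherent : weakly_coherent X.
Proof.
move=> x y; rewrite -compact_coverE compact_ultra => F UF Fxy.
have Fx : ultra_lim F x.
  by apply/ultra_limP => U oU; apply: filterS Fxy => t [/(_ U oU)].
have Fy : ultra_lim F y.
  by apply/ultra_limP => U oU; apply: filterS Fxy => t [_ /(_ U oU)].
have [z Fz zub] := lss_ultra_lim UF Fx.
by exists z; split=> //; split; apply: zub.
Qed.

(* The supremum is the largest limit of an ultrafilter containing the tails
   of D. *)
Lemma lss_directed D : directed D -> exists2 s, spec_sup D s &
  forall U, open U -> U s -> D `&` U !=set0.
Proof.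
move=> dD; have [d0 Dd0] := directed0 dD.
pose B d := D `&` upset d.
have PF : ProperFilter (filter_from D B).
  apply: filter_from_proper; last first.
    by move=> d Dd; exists d; split=> //; exact: spec_le_refl.
  apply: filter_from_filter; first by exists d0.
  move=> d e Dd De; have [f [Df df ef]] := directed2 dD Dd De.
  by exists f => // t [Dt ft]; split; split=> //; apply: spec_le_trans ft.
have [G [UG sG]] := ultraFilterLemma PF.
have GD d : D d -> G (B d) by move=> Dd; apply: sG; exists d.
have limD d : D d -> ultra_lim G d.
  move=> Dd; apply/ultra_limP => U oU.
  by apply: filterS (GD d Dd) => t [_ /(_ U oU)].
have [s Gs sub] := lss_ultra_lim UG (limD d0 Dd0).
have meet U : open U -> U s -> D `&` U !=set0.
  move=> oU Us; have GU : G U by move/ultra_limP : Gs; apply.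
  by have [t [[Dt _] Ut]] := filter_ex (filterI (GD d0 Dd0) GU); exists t.
(* Any open neighborhood of [s] meets [D], hence contains every upper bound of [D]; so [s] is
   least. *)
exists s => //; split=> [d /limD/sub //|u uub U [oU Us]].
by have [t [Dt Ut]] := meet U oU Us; apply: open_spec_le (uub t Dt) Ut.
Qed.

Lemma lss_monotone_convergence : monotone_convergence_space X.
Proof.
split=> [|D /lss_directed[s ? _]|U oU]; [exact: lss_kolmogorov|by exists s|].
split=> [x y|D s dD [_ smin] Us]; first exact: open_spec_le.
(* The given supremum [s] lies below the supremum [t] built from an ultrafilter, so [U] contains [t]
   and therefore meets [D]. *)
have [t [tub _] meet] := lss_directed dD.
by apply: meet => //; apply: open_spec_le (smin t tub) Us.
Qed.

End LocallyStronglySober.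
End Specialization.

Theorem theorem3p5 (X : topologicalType) :
  [<-> locally_strongly_sober X;
       [/\ weakly_hausdorff X, weakly_coherent X
         & monotone_convergence_space X];
       [/\ weakly_hausdorff X, coherent X & sober X]].
Proof.
tfae.
- move=> lss; split; [exact: lss_weakly_hausdorff|exact: lss_weakly_coherent|].
  exact: lss_monotone_convergence.
- move=> [wH wC mc]; split=> //; first exact: weakly_coherent_coherent.
  exact: monotone_convergence_sober.
- move=> [wH /coherent_weakly_coherent wC]; exact: sober_locally_strongly_sober.
Qed.
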